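(* For every connected graph $G$, $b(G)\le b_T(G)\le b(G)+1$.
   Context: For a finite simple graph $H$, a burning sequence is a sequence $(b_1,\dots,b_t)$ of vertices such that every vertex $v$ satisfies $d_H(v,b_i)\le t-i$ for some $i\in\{1,\dots,t\}$; $b(H)$ is the minimum length of a burning sequence. The total graph $T(G)$ has vertex set $V(G)\cup E(G)$, where two elements are adjacent iff they are adjacent vertices of $G$, or edges of $G$ sharing an endpoint, or a vertex and an edge incident to it. The total burning number of $G$ is $b_T(G)=b(T(G))$. *)

(* Defs.v *)
From mathcomp Require Import all_boot.

Set Implicit Arguments.
Unset Strict Implicit.
Unset Printing Implicit Defensive.

Record sgraph := SGraph {
  vertex :> finType;
  adj : rel vertex;
  adj_sym : symmetric adj;
  adj_irrefl : irreflexive adj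
}.

Definition connected_graph (G : sgraph) : Prop :=
  forall x y : G, connect (@adj G) x y.

Definition walk (G : sgraph) (n : nat) (x y : G) : bool :=
  [exists p : n.-tuple G, path (@adj G) x p && (last x p == y)].

Lemma connect_walk (G : sgraph) (x y : G) :
  connect (@adj G) x y -> exists n, walk n x y.
Proof.
case/connectP=> p pth ->; exists (size p).
by apply/existsP; exists (in_tuple p); rewrite /= pth eqxx.
Qed.

(* [None] stands for an infinite distance. *)
Definition dist (G : sgraph) (x y : G) : option nat :=
  match @idP (connect (@adj G) x y) with
  | ReflectT xy => Some (ex_minn (connect_walk xy))
  | ReflectF _ => None
  end.

Definition dist_le (G : sgraph) (x y : G) (k : nat) : bool :=
  if dist x y is Some d then d <= k else false.

(* Indices are shifted by one: [tnth b i] is b_(i+1), whence the radius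
   t - (i + 1). *)
Definition burning_sequence (G : sgraph) (t : nat) (b : t.-tuple G) : bool :=
  [forall v : G, [exists i : 'I_t, dist_le v (tnth b i) (t - i.+1)]].

Lemma dist_refl (G : sgraph) (x : G) : dist x x = Some 0.
Proof.
rewrite /dist; case: {-}_ / idP => [xx|[]]; last exact: connect0.
case: ex_minnP => n _ /(_ 0) n_min; congr Some.
apply/eqP; rewrite -leqn0; apply: n_min.
by apply/existsP; exists [tuple]; rewrite /= eqxx.
Qed.

Lemma burning_sequence_exists (G : sgraph) :
  exists t, [exists b : t.-tuple G, burning_sequence b].
Proof.
exists #|G|; apply/existsP; exists (enum_tuple G).
apply/forallP=> v; apply/existsP; exists (enum_rank v).
by rewrite /dist_le (tnth_nth v) -/(enum_val _) /= nth_enum_rank dist_refl.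
Qed.

Definition burning_number (G : sgraph) : nat :=
  ex_minn (burning_sequence_exists G).

Definition edges (G : sgraph) : {set {set G}} :=
  [set A : {set G} | [exists x, exists y, adj x y && (A == [set x; y])]].

Definition edge (G : sgraph) : finType := {A : {set G} | A \in edges G}.

Section TotalGraph.

Variable G : sgraph.

Definition total_adj (a b : G + edge G) : bool :=
  match a, b with
  | inl x, inl y => adj x y
  | inr A, inr B => (A != B) && (val A :&: val B != set0)
  | inl x, inr A | inr A, inl x => x \in val A
  end.

Lemma total_adj_sym : symmetric total_adj.
Proof.
by move=> [x|A] [y|B] //=; [exact: adj_sym | rewrite eq_sym setIC].
Qed.

Lemma total_adj_irrefl : irreflexive total_adj.
Proof. by case=> [x|A] /=; [exact: adj_irrefl | rewrite eqxx]. Qed.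

Definition total_graph : sgraph := SGraph total_adj_sym total_adj_irrefl.

End TotalGraph.

Definition total_burning_number (G : sgraph) : nat :=
  burning_number (total_graph G).

(* Main.v *)
Require Import Defs.
From mathcomp Require Import all_boot.

Set Implicit Arguments.
Unset Strict Implicit.
Unset Printing Implicit Defensive.

(** Replacing each edge of a burning sequence of T(G) by one of its endpoints
    gives a burning sequence of G, because a vertex at distance k from an edge
    in T(G) is at distance at most k in G from both endpoints. Conversely, an
    edge is adjacent in T(G) to its endpoints, so one more round of burning
    turns a burning sequence of G into one of T(G). *)

Section Distance.

Variable G : sgraph.
Implicit Types (x y z : G) (k m : nat).

(** The minimum in [dist] is the length of some walk and at most the length of every walk, so
    distance bounds reduce to exhibiting walks. *)
Lemma dist_leP x y k :
  reflect (exists p, [/\ path (@adj G) x p, last x p = y & size p <= k])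
          (dist_le x y k).
Proof.
rewrite /dist_le /dist; case: {-}_ / idP => [xy|nxy]; last first.
  by right=> -[p [px pl _]]; apply: nxy; apply/connectP; exists p.
case: ex_minnP => n walk_n n_min.
apply: (iffP idP) => [le_nk|[q [qx ql]]].
  have /existsP [p /andP [px /eqP pl]] := walk_n.
  by exists p; rewrite size_tuple.
apply: leq_trans; apply: n_min.
by apply/existsP; exists (in_tuple q); rewrite /= qx ql eqxx.
Qed.

Lemma dist_le0 x : dist_le x x 0.
Proof. by apply/dist_leP; exists [::]. Qed.

Lemma dist_le_adj x y : adj x y -> dist_le x y 1.
Proof. by move=> xy; apply/dist_leP; exists [:: y]; rewrite /= xy. Qed.

Lemma dist_leW x y k m : k <= m -> dist_le x y k -> dist_le x y m.
Proof.
move=> le_km /dist_leP [p [px pl le_pk]].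
by apply/dist_leP; exists p; rewrite (leq_trans le_pk).
Qed.

Lemma dist_le_trans x y z k m :
  dist_le x y k -> dist_le y z m -> dist_le x z (k + m).
Proof.
move=> /dist_leP [p [px pl pk]] /dist_leP [q [qx ql qm]].
apply/dist_leP; exists (p ++ q).
by rewrite cat_path last_cat size_cat px pl qx leq_add.
Qed.

End Distance.

Section BurningNumber.

Variable G : sgraph.

Lemma burning_number_min t (b : t.-tuple G) :
  burning_sequence b -> burning_number G <= t.
Proof.
rewrite /burning_number; case: ex_minnP => n _ n_min hb.
by apply: n_min; apply/existsP; exists b.
Qed.

Lemma burning_number_attained :
  exists b : (burning_number G).-tuple G, burning_sequence b.
Proof. by rewrite /burning_number; case: ex_minnP => n /existsP. Qed.

Lemma burning_sequenceP t (b : t.-tuple G) :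
  reflect (forall v, exists i : 'I_t, dist_le v (tnth b i) (t - i.+1))
          (burning_sequence b).
Proof. exact: 'forall_existsP. Qed.

Lemma burning_number_eq0 : #|G| = 0 -> burning_number G = 0.
Proof.
move/card0_eq=> G0; apply/eqP; rewrite -leqn0.
apply: (burning_number_min (b := [tuple])).
by apply/burning_sequenceP => v; have := G0 v.
Qed.

End BurningNumber.

Section TotalGraph.

Variable G : sgraph.

(** A vertex counts as its own single end, so that both kinds of elements of T(G) are treated
    alike. *)
Definition ends (a : total_graph G) : {set G} :=
  match a with inl x => [set x] | inr A => val A end.

Lemma ends_neq0 (a : total_graph G) : exists x, x \in ends a.
Proof.
case: a => [x|A]; first by exists x; rewrite /= set11.
have := valP A; rewrite inE => /existsP [x /existsP [y /andP [_ /eqP defA]]].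
by exists x; rewrite /= defA set21.
Qed.

Lemma edge_dist_le1 (A : edge G) x y :
  x \in val A -> y \in val A -> dist_le x y 1.
Proof.
have := valP A; rewrite inE => /existsP [u /existsP [v /andP [uv /eqP ->]]].
have vu : adj v u by rewrite adj_sym.
by move=> /set2P [] -> /set2P [] ->;
  first [exact: dist_le_adj | exact: dist_leW (dist_le0 _)].
Qed.

(** If [b] is an edge, some end of [a] lies on it, hence within one step of [y]. The end of [b] is
    prescribed and that of [a] is chosen, so walks are traced backwards. *)
Lemma total_adj_ends (a b : total_graph G) y :
  adj a b -> y \in ends b -> exists2 x, x \in ends a & dist_le x y 1.
Proof.
case: a b => [x|A] [z|B] /=.
- by move=> xz /set1P ->; exists x; rewrite ?set11 ?dist_le_adj.
- by move=> xB yB; exists x; rewrite ?set11 // (@edge_dist_le1 B).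
- by move=> zA /set1P ->; exists z => //; apply: dist_leW (dist_le0 _).
- case/andP=> _ /set0Pn [z /setIP [zA zB]] yB.
  by exists z => //; apply: (@edge_dist_le1 B).
Qed.

Lemma total_dist_le_ends (v : G) (a : total_graph G) k y :
  dist_le (inl v : total_graph G) a k -> y \in ends a -> dist_le v y k.
Proof.
case/dist_leP=> p [px <- le_pk] ya; apply: dist_leW le_pk _.
(* Peeling off the last element leaves the start [v] fixed; on reaching it, the chosen end must be
   [v] itself. *)
elim/last_ind: p y px ya => [|p b IHp] y /=.
  by move=> _ /set1P ->; apply: dist_le0.
rewrite rcons_path last_rcons size_rcons => /andP [px pb] yb.
have [x xa xy] := total_adj_ends pb yb.
by rewrite -addn1; apply: dist_le_trans (IHp x px xa) xy.
Qed.

Lemma dist_le_total (x y : G) k :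
  dist_le x y k -> dist_le (inl x : total_graph G) (inl y) k.
Proof.
case/dist_leP=> p [px <- le_pk]; apply/dist_leP; exists (map inl p).
by rewrite size_map last_map path_map.
Qed.

Lemma burning_number_le_total : burning_number G <= total_burning_number G.
Proof.
have [b /burning_sequenceP hb] := burning_number_attained (total_graph G).
(* Any choice of ends works: [total_dist_le_ends] bounds the distance to all of them. *)
pose f a := xchoose (ends_neq0 a).
apply: (@burning_number_min _ _ (map_tuple f b)).
apply/burning_sequenceP => v; have [i hi] := hb (inl v).
exists i; rewrite tnth_map; apply: total_dist_le_ends hi _.
exact: xchooseP.
Qed.

Lemma total_burning_number_leS :
  total_burning_number G <= (burning_number G).+1.
Proof.
(* The empty graph has no vertex to append to a sequence, so it is treated apart. *)
have [/card0_eq G0|] := posnP #|G|.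
  rewrite /total_burning_number burning_number_eq0 //.
  by apply: eq_card0 => a; have [x _] := ends_neq0 a; have := G0 x.
case/card_gt0P=> x0 _.
have [b /burning_sequenceP hb] := burning_number_attained G.
set t := burning_number G in b hb *.
(* The last entry is arbitrary: it serves only to raise the radius of each earlier entry by one. *)
pose c := [tuple of rcons (map (@inl G (edge G)) b) (inl x0)].
apply: (@burning_number_min (total_graph G) _ c).
have near (v : G) : exists i : 'I_t,
    dist_le (inl v : total_graph G) (tnth c (widen_ord (leqnSn t) i))
            (t - i.+1).
  have [i hi] := hb v; exists i; move: (dist_le_total hi).
  rewrite (tnth_nth (inl x0)) /= nth_rcons size_map size_tuple ltn_ord.
  by rewrite (nth_map x0) ?size_tuple // -tnth_nth.
apply/burning_sequenceP => a.
have [x xa] := ends_neq0 a; have [i hi] := near x.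
exists (widen_ord (leqnSn t) i).
(* As [i < t], the radius splits as 1 + (t - (i + 1)); the 1 pays for the step from [a] to its end
   [x]. *)
rewrite /= subSn ?ltn_ord // -[(t - _).+1]add1n; apply: dist_le_trans hi.
case: a xa => [v|A] /= => [/set1P ->|xA]; last exact: dist_le_adj.
by apply: dist_leW (dist_le0 _).
Qed.

End TotalGraph.

Theorem theorem7 (G : sgraph) (hG : connected_graph G) :
  burning_number G <= total_burning_number G <= burning_number G + 1.
Proof. by rewrite burning_number_le_total addn1 total_burning_number_leS. Qed.
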